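(* A set $E\subseteq\mathbb{R}$ is monotone $\operatorname{lip}1$ if and only if $E$ is strongly one-sided dense and its complement $E^c=\mathbb{R}\setminus E$ is weakly center dense.
   Context: For a continuous $f:\mathbb{R}\to\mathbb{R}$, $x\in\mathbb{R}$ and $r>0$ put $M_f(x,r)=\frac{1}{r}\sup\{|f(x)-f(y)|:|x-y|\le r\}$ and $\operatorname{lip} f(x)=\liminf_{r\to0^+}M_f(x,r)$. A set $E\subseteq\mathbb{R}$ is monotone $\operatorname{lip}1$ if there is a continuous, monotone function $f:\mathbb{R}\to\mathbb{R}$ with $\operatorname{lip} f=\mathbf{1}_E$ (the characteristic function of $E$). $|A|$ denotes the Lebesgue measure of $A$. A measurable set $S$ is weakly center dense at $x$ if there exists a sequence of non-degenerate closed intervals $\{I_n\}$, each centered at $x$, with $|I_n|\to0$ and $\frac{|S\cap I_n|}{|I_n|}\to1$. A measurable set $S$ is strongly one-sided dense at $x$ if for every sequence $r_n\searrow0$ of positive numbers we have $\max\left\{\frac{|S\cap[x-r_n,x]|}{r_n},\frac{|S\cap[x,x+r_n]|}{r_n}\right\}\to1$. $S$ is weakly center dense (strongly one-sided dense) if it is so at every $x\in S$; these properties include measurability of $S$. *)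

(* Defs.v *)
From HB Require Import structures.
From mathcomp Require Import all_boot all_order all_algebra.
From mathcomp Require Import all_classical all_reals all_analysis.

Set Implicit Arguments.
Unset Strict Implicit.
Unset Printing Implicit Defensive.
Import Order.TTheory GRing.Theory Num.Theory.
Import numFieldNormedType.Exports.

Local Open Scope classical_set_scope.
Local Open Scope ring_scope.

(** [M_f(x, r)] and [lip f x] take values in [\bar R]: for continuous [f] and
    [r > 0] the supremum is finite, but the lower limit may be [+oo]. *)
Definition lip_quot (R : realType) (f : R -> R) (x r : R) : \bar R :=
  ((r^-1)%:E * ereal_sup [set `|f x - f y|%:E | y in [set y | `|x - y| <= r]%R])%E.

Definition lip (R : realType) (f : R -> R) (x : R) : \bar R :=
  limf_einf (lip_quot f x) 0^'+.

Definition monotone_fun (R : realType) (f : R -> R) : Prop :=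
  {homo f : x y / x <= y} \/ {homo f : x y /~ x <= y}.

Definition monotone_lip1 (R : realType) (E : set R) : Prop :=
  exists f : R -> R,
    [/\ continuous f, monotone_fun f & forall x, lip f x = (\1_E x)%:E].

(** Lebesgue (not merely Borel) measurability: this sigma-algebra is the
    completion of the Borel one ([completed_caratheodory_measurable]), and the
    one on which [completed_lebesgue_measure] is a measure. *)
Definition lebesgue_measurable (R : realType) (S : set R) : Prop :=
  ((wlength idfun)^*)%mu.-cara.-measurable S.

(** Only used on bounded sets, where [fine] loses no information. *)
Definition leb (R : realType) (A : set R) : R :=
  fine (completed_lebesgue_measure A).

Definition weakly_center_dense_at (R : realType) (S : set R) (x : R) : Prop :=
  exists r : nat -> R,
    let I n := `[x - r n, x + r n]%classic in
    [/\ forall n, 0 < r n,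
        leb (I n) @[n --> \oo] --> (0 : R)
      & leb (S `&` I n) / leb (I n) @[n --> \oo] --> (1 : R)].

Definition strongly_one_sided_dense_at (R : realType) (S : set R) (x : R) :
    Prop :=
  forall r : nat -> R,
    (forall n, 0 < r n) -> nonincreasing_seq r -> r @ \oo --> (0 : R) ->
    Num.max (leb (S `&` `[x - r n, x]) / r n)
            (leb (S `&` `[x, x + r n]) / r n) @[n --> \oo] --> (1 : R).

Definition weakly_center_dense (R : realType) (S : set R) : Prop :=
  lebesgue_measurable S /\ forall x, S x -> weakly_center_dense_at S x.

Definition strongly_one_sided_dense (R : realType) (S : set R) : Prop :=
  lebesgue_measurable S /\ forall x, S x -> strongly_one_sided_dense_at S x.

(* Main.v *)
Require Import Defs.
From HB Require Import structures.
From mathcomp Require Import all_boot all_order all_algebra.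
From mathcomp Require Import all_classical all_reals all_analysis.
From mathcomp Require Import measurable_realfun ring lra.

Set Implicit Arguments.
Unset Strict Implicit.
Unset Printing Implicit Defensive.
Import Order.TTheory GRing.Theory Num.Theory.
Import numFieldNormedType.Exports.

Local Open Scope classical_set_scope.
Local Open Scope ring_scope.

(** The pivot is the identity [f b - f a = leb (E `&` `[a, b])].  When it holds,
    the one-sided difference quotients of [f] are the one-sided densities of [E],
    and [lip f x] is the lower limit of their maximum, a number in [[0, 1]]: it is
    [1] iff [E] is strongly one-sided dense at [x], and [0] iff the complement of
    [E] is weakly center dense at [x].  Given the density conditions, a primitive
    of the indicator of [E] therefore works.  Conversely, if [f] is nondecreasing
    and [lip f = \1_E], then [lip f <= 1] makes [f] 1-Lipschitz, so its
    Stieltjes measure has a density with respect to Lebesgue measure; this density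
    is almost everywhere the derivative of [f], hence [lip f], hence [\1_E]. *)

(** * Lower limits at [0^'+], tested on the intervals []0, d[] *)

Section liminf_at_right.
Variable R : realType.
Implicit Types (q : R -> \bar R) (c : \bar R).

Lemma le_limf_einf_at_right q c (d : R) : 0 < d ->
  (forall r, 0 < r < d -> (c <= q r)%E) -> (c <= limf_einf q 0^'+)%E.
Proof.
move=> d0 H; rewrite limf_einfE.
apply: (@le_trans _ _ (ereal_inf (q @` `]0, d[%classic))).
  by apply: le_ereal_inf_tmp => _ [r /= + <-]; rewrite in_itv/= => /H.
apply: ereal_sup_ubound; exists `]0, d[%classic => //.
exists d => //= y; rewrite /ball_ /= sub0r normrN in_itv/= => yd y0.
by rewrite y0 -(gtr0_norm y0).
Qed.

Lemma lt_limf_einf_at_right q c : (c < limf_einf q 0^'+)%E ->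
  exists2 d : R, 0 < d & forall r, 0 < r < d -> (c < q r)%E.
Proof.
rewrite limf_einfE => /ereal_sup_gt[_ [V V0 <-] cV].
move: V0 => [d /= d0 dV]; exists d => // r /andP[r0 rd].
apply: (lt_le_trans cV); apply: ereal_inf_lbound; exists r => //.
by apply: dV => //=; rewrite sub0r normrN gtr0_norm.
Qed.

Lemma limf_einf_at_right_le q c :
  (forall d : R, 0 < d -> exists2 r, 0 < r < d & (q r <= c)%E) ->
  (limf_einf q 0^'+ <= c)%E.
Proof.
move=> H; rewrite leNgt; apply/negP => /lt_limf_einf_at_right[d d0 cq].
by have [r /cq] := H _ d0; rewrite ltNge => /negP.
Qed.

Lemma limf_einf_at_right_lt q c (d : R) : 0 < d -> (limf_einf q 0^'+ < c)%E ->
  exists2 r, 0 < r < d & (q r < c)%E.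
Proof.
move=> d0; apply: contraPP => /forall2NP H; apply/negP; rewrite -leNgt.
apply: (le_limf_einf_at_right d0) => r rd.
by rewrite leNgt; apply/negP => qc; case: (H r).
Qed.

End liminf_at_right.

(** * One-sided difference quotients of nondecreasing functions *)

Section one_sided_quotient.
Variable R : realType.
Implicit Types (f : R -> R) (x r : R).

Definition oscq f x r : R :=
  Num.max ((f x - f (x - r)) / r) ((f (x + r) - f x) / r).

(** Monotonicity bounds the variation on each side of [x] by its value at the endpoint [x - r] or
    [x + r], so the supremum is attained there and is finite. *)
Lemma lip_quotE f x r : {homo f : x y / x <= y} -> 0 < r ->
  lip_quot f x r = (oscq f x r)%:E.
Proof.
move=> nf r0; rewrite /lip_quot /oscq.
have -> : ereal_sup [set `|f x - f y|%:E | y in [set y | `|x - y| <= r]] =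
   (Num.max (f x - f (x - r)) (f (x + r) - f x))%:E.
  apply/eqP; rewrite eq_le; apply/andP; split.
    apply: ge_ereal_sup => _ [y /= + <-]; rewrite ler_norml lee_fin.
    move=> /andP[xy1 xy2]; rewrite le_max.
    have h1 : f (x - r) <= f y by apply: nf; lra.
    have h2 : f y <= f (x + r) by apply: nf; lra.
    have [xy|/ltW yx] := leP x y.
      apply/orP; right; have := nf _ _ xy => h3.
      by rewrite ler0_norm; lra.
    apply/orP; left; have := nf _ _ yx => h3.
    by rewrite ger0_norm; lra.
  rewrite EFin_max ge_max; apply/andP; split; apply: ereal_sup_ubound.
    exists (x - r); first by rewrite /= subKr gtr0_norm.
    by rewrite ger0_norm// subr_ge0 nf// gerBl ltW.
  exists (x + r); first by rewrite /= opprD addNKr normrN gtr0_norm.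
  by rewrite ler0_norm ?opprB// subr_le0 nf// lerDl ltW.
by rewrite -EFinM maxr_pMr ?invr_ge0 ?ltW// !(mulrC r^-1).
Qed.

Lemma oscq_ge0 f x r : {homo f : x y / x <= y} -> 0 < r -> 0 <= oscq f x r.
Proof.
move=> nf r0; rewrite le_max divr_ge0 ?(ltW r0)// subr_ge0 nf//.
by rewrite gerBl ltW.
Qed.

(** An upper bound on a lower limit concerns some arbitrarily small radii, whereas a lower bound
    ([ge_lipP]) concerns all small radii. This asymmetry later matches weak density (some sequence)
    against strong density (every sequence). *)
Lemma le_lipP f x (c : R) : {homo f : x y / x <= y} ->
  (lip f x <= c%:E)%E <->
  (forall e d : R, 0 < e -> 0 < d -> exists2 r, 0 < r < d & oscq f x r < c + e).
Proof.
move=> nf; split=> [fc e d e0 d0|H].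
  have : (lip f x < (c + e)%:E)%E by rewrite (le_lt_trans fc)// lte_fin ltrDl.
  move=> /(limf_einf_at_right_lt d0)[r /andP[r0 rd]].
  by rewrite lip_quotE// lte_fin => ?; exists r => //; rewrite r0.
apply/lee_addgt0Pr => e e0; apply: limf_einf_at_right_le => d d0.
have [r /andP[r0 rd] qr] := H e d e0 d0; exists r; first by rewrite r0.
by rewrite lip_quotE// lee_fin ltW.
Qed.

Lemma ge_lipP f x (c : R) : {homo f : x y / x <= y} ->
  (c%:E <= lip f x)%E <->
  (forall e : R, 0 < e -> exists2 d, 0 < d &
    forall r, 0 < r < d -> c - e < oscq f x r).
Proof.
move=> nf; split=> [fc e e0|H].
  have : ((c - e)%:E < lip f x)%E.
    by rewrite (lt_le_trans _ fc)// lte_fin gtrBl.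
  move=> /lt_limf_einf_at_right[d d0 H]; exists d => // r /[dup] /H.
  by move=> /[swap] /andP[r0 _]; rewrite lip_quotE// lte_fin.
apply/lee_subgt0Pr => e e0; have [d d0 {}H] := H e e0.
apply: (le_limf_einf_at_right d0) => r /[dup] /andP[r0 _] /H.
by rewrite lip_quotE// lee_fin => /ltW.
Qed.

Lemma lip_oppr f x : lip (\- f) x = lip f x.
Proof.
suff qE r : lip_quot (\- f) x r = lip_quot f x r by rewrite /lip (funext qE).
congr (_ * ereal_sup _)%E; apply: eq_imagel => y _ /=.
by rewrite opprK addrC distrC.
Qed.

(* The set of [x <= b] with [f x - f a <= c (x - a)] is closed, and by the
   hypothesis it contains points to the right of each of its points below [b]. *)
Lemma lip_le_lipschitz f (c a b : R) : continuous f ->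
  {homo f : x y / x <= y} -> (forall x, (lip f x <= c%:E)%E) -> a <= b ->
  f b - f a <= c * (b - a).
Proof.
move=> cf nf fc ab.
(* The slack [e] is there because the lower limit only provides radii whose quotient is below
   [c + e]. *)
suff H (e : R) : 0 < e -> f b - f a <= (c + e) * (b - a).
  move: ab; rewrite le_eqVlt => /predU1P[->|ab]; first by rewrite !subrr mulr0.
  rewrite -ler_pdivrMr ?subr_gt0//; apply/ler_addgt0Pr => e e0.
  by rewrite ler_pdivrMr ?subr_gt0// H.
move=> e0; pose g x := (c + e) * (x - a) - (f x - f a).
have cg : continuous g.
  move=> x; apply: cvgB.
    by apply: cvgM; [exact: cvg_cst|apply: cvgB; [exact: cvg_id|exact: cvg_cst]].
  by apply: cvgB; [exact: cf|exact: cvg_cst].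
pose S := [set x | a <= x <= b /\ 0 <= g x].
have Sa : S a by split; [rewrite lexx|rewrite /g !subrr mulr0].
have ubS : ubound S b by move=> x [/andP[]].
have hS : has_sup S by split; [exists a|exists b].
have clS : closed S.
  have -> : S = `[a, b]%classic `&` g @^-1` [set y | 0 <= y].
    by apply/seteqP; split => x /=; rewrite in_itv.
  apply: closedI; first exact: interval_closed.
  by apply: preimage_closed; [move=> x _; exact: cg|exact: closed_ge].
have [/andP[as_ sb] gs] : S (sup S) by apply: clS; apply: closure_sup; [exact: hS.1|exact: hS.2].
move: sb; rewrite le_eqVlt => /predU1P[sb|sb].
  by rewrite -subr_ge0 -sb.
have bs0 : 0 < b - sup S by rewrite subr_gt0.
have [r /andP[r0 rb]] := (le_lipP (sup S) c nf).1 (fc _) _ _ e0 bs0.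
rewrite gt_max => /andP[_]; rewrite ltr_pdivrMr// => fr.
have : S (sup S + r).
  split; first by apply/andP; split; lra.
  by rewrite /g; move: gs; rewrite /g; nra.
by move=> /(ub_le_sup hS.2); lra.
Qed.

End one_sided_quotient.

(** * Absolute continuity and densities of Stieltjes measures *)

Section lipschitz_density.
Variable R : realType.
Notation mu := (@lebesgue_measure R).
Implicit Types (f : R -> R).

Lemma cumulative_of_continuous f : continuous f -> {homo f : x y / x <= y} ->
  exists g : cumulative R R, g = f :> (R -> R).
Proof.
move=> cf nf.
pose fC := isCumulative.Build _ _ _ f nf (right_continuousW cf).
pose g : cumulative R R := HB.pack f fC.
by exists g.
Qed.

Lemma lebesgue_stieltjes_measure_itvoc (g : cumulative R R) (a b : R) :
  a <= b -> lebesgue_stieltjes_measure g `]a, b]%classic = (g b - g a)%:E.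
Proof.
move=> ab; rewrite -(wlength_itv_bnd g false false ab) /lebesgue_stieltjes_measure.
by apply: measurable_mu_extE; exact: is_ocitv.
Qed.

(* The Stieltjes measures of [f] and of [id - f] add up to Lebesgue measure. *)
Lemma lipschitz_stieltjes_dominated (g : cumulative R R) : continuous g ->
  (forall a b : R, a <= b -> g b - g a <= b - a) ->
  lebesgue_stieltjes_measure g `<< mu.
Proof.
move=> cg lg.
have [h hE] : exists h : cumulative R R, h = (fun x => x - g x) :> (R -> R).
  apply: cumulative_of_continuous => [x|a b ab].
    by apply: cvgB; [exact: cvg_id|exact: cg].
  by have := lg _ _ ab; lra.
apply/null_content_dominatesP => A mA.
have muE : mu A = (lebesgue_stieltjes_measure g A +
    lebesgue_stieltjes_measure h A)%E.
  rewrite -measure_addE; apply: lebesgue_measure_unique => // _ [[x y] _ <-] /=.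
  rewrite [RHS]measure_addE; have [xy|yx] := leP x y; last first.
    by rewrite set_itv_ge ?bnd_simp -?leNgt ?(ltW yx)// !measure0 adde0.
  transitivity (y - x)%:E; first exact: lebesgue_stieltjes_measure_itvoc.
  have -> : y - x = (g y - g x) + (h y - h x) by rewrite hE; ring.
  by rewrite EFinD; congr (_ + _)%E; apply/esym;
    exact: lebesgue_stieltjes_measure_itvoc.
move=> /eqP; rewrite -[X in X == _]/(mu A) muE padde_eq0//.
by case/andP => /eqP.
Qed.

(** Radon-Nikodym applied to the Stieltjes measure of [f], restricted to []a, b]] so that it is
    finite and [h] is integrable on the whole line. *)
Lemma lipschitz_density f (a b : R) : continuous f ->
  {homo f : x y / x <= y} ->
  (forall x y : R, x <= y -> f y - f x <= y - x) ->
  exists2 h : R -> R, mu.-integrable setT (EFin \o h) &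
  forall x y, a <= x -> x <= y -> y <= b ->
    (\int[mu]_(t in `]x, y]) (h t)%:E = (f y - f x)%:E)%E.
Proof.
move=> cf nf lf; have [g gE] := cumulative_of_continuous cf nf.
have mD : measurable (`]a, b]%classic : set (measurableTypeR R)).
  exact: measurable_itv.
have [ab|/ltW ba] := leP a b; last first.
  (* For [b <= a] the bounds on [x] and [y] force [x = y], so any integrable function serves. *)
  exists (cst 0); first exact: integrable0.
  move=> x y ax xy yb; rewrite integral0.
  by rewrite (_ : y = x) ?subrr//; lra.
pose nu := lebesgue_stieltjes_measure g.
have nuD : (nu `]a, b]%classic < +oo)%E.
  by rewrite /nu lebesgue_stieltjes_measure_itvoc// ltry.
pose nuab := mfrestr mD nuD.
have dom : nuab `<< mu.
  apply/null_content_dominatesP => A mA A0.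
  have : nu `<< mu by apply: lipschitz_stieltjes_dominated; rewrite gE.
  move=> /null_content_dominatesP /(_ _ mA A0) nuA.
  rewrite /nuab /mfrestr /mrestr.
  by apply: subset_measure0 nuA => //; exact: measurableI.
pose h := Radon_Nikodym_SigmaFinite.f nuab mu.
have hfin x : (fine (h x))%:E = h x.
  by rewrite fineK//; exact: Radon_Nikodym_SigmaFinite.f_fin_num.
exists (fine \o h).
  rewrite (_ : EFin \o _ = h); first exact: Radon_Nikodym_SigmaFinite.f_integrable.
  by apply/funext.
move=> x y ax xy yb.
transitivity (nuab `]x, y]%classic).
  rewrite (eq_integral h) => [|t _]; last by rewrite hfin.
  by apply/esym/(Radon_Nikodym_SigmaFinite.f_integral dom); exact: measurable_itv.
rewrite /nuab /mfrestr /mrestr setIidl.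
  by rewrite -gE; exact: lebesgue_stieltjes_measure_itvoc.
move=> t /=; rewrite !in_itv/= => /andP[xt ty].
by rewrite (le_lt_trans ax xt) (le_trans ty yb).
Qed.

End lipschitz_density.

(** * From [lip f = \1_E] to the measure identity *)

Section lip_density.
Variable R : realType.
Notation mu := (@lebesgue_measure R).
Implicit Types (f : R -> R) (E : set R).

Lemma derivable1_quotient f (x e : R) : derivable f x 1 -> 0 < e ->
  exists2 d, 0 < d & forall k, k != 0 -> `|k| < d ->
    `|(f (x + k) - f x) / k - f^`()%classic x| < e.
Proof.
move=> /cvg_ex[l fl] e0.
have -> : f^`()%classic x = l.
  rewrite derive1E; apply: (cvg_lim _ fl); exact: Rhausdorff.
move/cvgrPdist_lt : fl => /(_ _ e0)[d /= d0 H].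
exists d => // k k0 kd; have := H k; rewrite /ball_/= sub0r normrN => /(_ kd k0).
by rewrite distrC /GRing.scale /= mulr1 (addrC k) mulrC.
Qed.

Lemma lip_of_quotient f (x c : R) : {homo f : x y / x <= y} ->
  (forall e, 0 < e -> exists2 d, 0 < d & forall k, k != 0 -> `|k| < d ->
    `|(f (x + k) - f x) / k - c| < e) ->
  lip f x = c%:E.
Proof.
move=> nf H.
have Q e : 0 < e -> exists2 d, 0 < d & forall r, 0 < r < d ->
    c - e < oscq f x r < c + e.
  move=> e0; have [d d0 {}H] := H _ e0; exists d => // r /andP[r0 rd].
  have := H r; rewrite gt_eqF// gtr0_norm// => /(_ isT rd).
  have := H (- r); rewrite oppr_eq0 gt_eqF// normrN gtr0_norm// => /(_ isT rd).
  have -> : (f (x - r) - f x) / - r = (f x - f (x - r)) / r.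
    by rewrite invrN mulrN -mulNr opprB.
  rewrite !ltr_norml lt_max gt_max => /andP[h1 h2] /andP[h3 h4].
  by apply/andP; split; [apply/orP; left|apply/andP; split]; lra.
apply/eqP; rewrite eq_le; apply/andP; split.
  apply/le_lipP => // e d e0 d0; have [d' d'0 {}Q] := Q _ e0.
  have m0 : 0 < Num.min d d' by rewrite lt_min d0.
  have md : Num.min d d' <= d by rewrite ge_min lexx.
  have md' : Num.min d d' <= d' by rewrite ge_min lexx orbT.
  exists (Num.min d d' / 2); first by rewrite divr_gt0//=; lra.
  have /Q/andP[] // : 0 < Num.min d d' / 2 < d'.
  by rewrite divr_gt0//=; lra.
apply/ge_lipP => // e e0; have [d d0 {}Q] := Q _ e0.
by exists d => // r /Q /andP[].
Qed.

(** By Lebesgue differentiation the primitive of the density from [a] has derivative [h x] at almost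
    every [x > a]; on []a, b[] this primitive is [f] up to a constant. *)
Lemma lipschitz_lip_density f (a b : R) : continuous f ->
  {homo f : x y / x <= y} ->
  (forall x y : R, x <= y -> f y - f x <= y - x) ->
  exists h : R -> R, [/\ mu.-integrable setT (EFin \o h),
  forall x y, a <= x -> x <= y -> y <= b ->
    (\int[mu]_(t in `]x, y]) (h t)%:E = (f y - f x)%:E)%E &
  {ae mu, forall x, a < x < b -> lip f x = (h x)%:E}].
Proof.
move=> cf nf lf; have [h ih hE] := lipschitz_density a b cf nf lf.
exists h; split => //.
have loch : locally_integrable setT h.
  by apply: open_integrable_locally => //; exact: openT.
have ihy y : mu.-integrable [set` Interval (BRight a) (BRight y)] (EFin \o h).
  by apply: integrableS ih => //; exact: measurable_itv.
have := FTC1 ihy loch.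
apply: filterS; first exact: (ae_filter_ringOfSetsType mu).
move=> x /= + /andP[ax xb] => /(_ ax)[dF F'].
apply: lip_of_quotient => // e e0.
have [d d0 {}dF] := derivable1_quotient dF e0.
(* The bound [m] keeps [x + k] between [a] and [b], where the integral of [h] is an increment of
   [f]. *)
pose m := Num.min d (Num.min (x - a) (b - x)).
have m0 : 0 < m by rewrite !lt_min d0 !subr_gt0 ax.
exists m => // k k0; rewrite !lt_min => /and3P[kd kxa kbx].
have := dF k k0 kd; rewrite F'.
have FE y : a <= y -> y <= b -> (\int[mu]_(t in `]a, y]) h t)%R = f y - f a.
  by move=> ay yb; rewrite /Rintegral hE.
have := ler_norm k; have := ler_norm (- k); rewrite normrN => k1 k2.
by rewrite !FE; [|lra..]; rewrite opprB addrA subrK.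
Qed.

(** Both measures are the same outer measure on different sigma-algebras, so the values agree by
    conversion. *)
Lemma completed_lebesgue_measureE (A : set R) :
  completed_lebesgue_measure A = mu A.
Proof. by []. Qed.

(** Measurability of [E] is a conclusion: on [[a, b]], [E] agrees outside a null set with the level
    set [h = 1] of a measurable density, and the measure is complete. *)
Lemma lip_indic_leb f E : continuous f -> {homo f : x y / x <= y} ->
  (forall x, lip f x = (\1_E x)%:E) ->
  lebesgue_measurable E /\
  forall a b, a <= b -> leb (E `&` `[a, b]) = f b - f a.
Proof.
move=> cf nf fE.
have lf x y : x <= y -> f y - f x <= y - x.
  rewrite -[y - x]mul1r; apply: lip_le_lipschitz => // z.
  by rewrite fE lee_fin indicE; case: (_ \in _).
have H a b : a <= b -> lebesgue_measurable (E `&` `[a, b]) /\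
    completed_lebesgue_measure (E `&` `[a, b]) = (f b - f a)%:E.
  move=> ab.
  (* The margin of 1 puts the closed interval [[a, b]] inside the open interval on which [lip f = h]
     holds almost everywhere. *)
  have [h [ih hE [N [mN N0 NE]]]] :=
    lipschitz_lip_density (a - 1) (b + 1) cf nf lf.
  pose A := (h @^-1` [set 1]) `&` `[a, b].
  have mh : measurable_fun setT h.
    by apply/measurable_EFinP; exact: measurable_int ih.
  have mA : measurable (A : set (measurableTypeR R)).
    apply: measurableI; last exact: measurable_itv.
    by rewrite -[X in measurable X]setTI; exact: mh.
  have hN x : a <= x <= b -> ~ N x -> h x = \1_E x.
    move=> /andP[ax xb] Nx.
    have /contrapT : ~ ~ (a - 1 < x < b + 1 -> lip f x = (h x)%:E).
      by move=> xN; exact/Nx/NE.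
    rewrite fE => hx; apply/esym/EFin_inj/hx.
    by apply/andP; split; lra.
  have EA : (E `&` `[a, b]) `\` N = A `\` N.
    apply/seteqP; split=> x /=; rewrite /A /= in_itv/= => -[[Ex xab] Nx].
      by rewrite hN// indicE mem_set.
    do 2?split => //; move: Ex; rewrite hN// indicE.
    case: (boolP (x \in E)) => [/set_mem//|_].
    by move=> /esym/eqP; rewrite oner_eq0.
  have cN : lebesgue_measurable N by exact: sub_caratheodory.
  have cA : lebesgue_measurable A by exact: sub_caratheodory.
  have nEN : completed_lebesgue_measure.-negligible (E `&` `[a, b] `&` N).
    by exists N; split.
  have cEN := completed_lebesgue_measure_is_complete nEN.
  have cE : lebesgue_measurable (E `&` `[a, b]).
    rewrite -(setUIDK (E `&` `[a, b]) N) EA.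
    by apply: measurableU => //; exact: measurableD.
  split => //.
  have N0' (S : set R) : lebesgue_measurable S ->
      completed_lebesgue_measure S = completed_lebesgue_measure (S `\` N).
    move=> mS; rewrite (measureDI _ mS cN) [X in (_ + X)%E](_ : _ = 0%E) ?adde0//.
    apply: measure_negligible; first exact: measurableI.
    by exists N; split => // x [].
  rewrite N0'// EA -N0'// completed_lebesgue_measureE.
  rewrite -hE; [|lra..].
  have mhD (D : set (measurableTypeR R)) : measurable_fun D (EFin \o h).
    by apply: measurable_funTS; exact/measurable_EFinP.
  rewrite integral_itv_obnd_cbnd; last exact: mhD.
  (* Off [N] the density equals [\1_E] on [[a, b]], so it takes only the values 0 and 1 and
     coincides with the indicator of its level set [A]. *)
  rewrite (@ae_eq_integral _ _ _ mu _ (EFin \o \1_A))//.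
  - by rewrite integral_indic// /A -setIA setIid.
  - by apply: measurable_funTS; exact/measurable_EFinP/measurable_indic.
  - exists N; split => // x /= xN; apply: contrapT => Nx; apply: xN => xab.
    move: (xab); rewrite in_itv/= => /hN /(_ Nx) hx; congr EFin; rewrite indicE.
    have [xA|xA] := boolP (x \in A); first by move/set_mem: xA => -[].
    rewrite hx indicE; case: (boolP (x \in E)) => // xE.
    move/negP: xA => []; apply/mem_set; split => //=.
    by rewrite hx indicE xE.
split.
  rewrite (_ : E = \bigcup_n (E `&` `[- n%:R, n%:R])).
    apply: bigcupT_measurable => n; apply: (H _ _ _).1.
    by rewrite -subr_ge0 opprK addr_ge0.
  rewrite -setI_bigcupr -[LHS]setIT; congr (_ `&` _); apply/esym.
  rewrite -subTset => x _; exists (Num.bound `|x|) => //=.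
  by rewrite in_itv/= -ler_norml ltW// archi_boundP.
by move=> a b /H[_]; rewrite /leb => ->.
Qed.

End lip_density.

(** * Sequences of radii decreasing to zero *)

Lemma small_positive_seq (R : realType) (P : nat -> R -> Prop) :
  (forall n (d : R), 0 < d -> exists2 r, 0 < r < d & P n r) ->
  exists s : nat -> R, [/\ forall n, 0 < s n, nonincreasing_seq s,
    s @ \oo --> (0 : R) & forall n, P n (s n)].
Proof.
move=> H.
have /choice[g gP] (nd : nat * R) :
    exists r, 0 < nd.2 -> 0 < r < nd.2 /\ P nd.1 r.
  have [d0|] := boolP (0 < nd.2); last by exists 0.
  by have [r rd Pr] := H nd.1 _ d0; exists r.
(* Each radius is chosen below its predecessor, for monotonicity, and below the next reciprocal, for
   convergence to 0. *)
pose s := fix s n : R := if n is m.+1 then g (m.+1, Num.min (s m) m.+2%:R^-1)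
  else g (0%N, 1).
have s0 n : 0 < s n.
  elim: n => [|n IH]; first by have [|/andP[]] := gP (0%N, 1).
  have [|/andP[]//] := gP (n.+1, Num.min (s n) n.+2%:R^-1).
  by rewrite /= lt_min IH invr_gt0 ltr0n.
have sS n : s n.+1 < Num.min (s n) n.+2%:R^-1 /\ P n.+1 (s n.+1).
  have [|/andP[]//] := gP (n.+1, Num.min (s n) n.+2%:R^-1).
  by rewrite /= lt_min s0 invr_gt0 ltr0n.
exists s; split => //.
- by apply/nonincreasing_seqP => n; have [+ _] := sS n; rewrite lt_min => /andP[/ltW].
- apply: (@squeeze_cvgr _ _ _ _ (cst 0) (fun n => n.+1%:R^-1)).
  + apply: nearW => n; rewrite (ltW (s0 n))/=; case: n => [|n] /=.
      by rewrite invr1; have [|/andP[_ /ltW]] := gP (0%N, 1).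
    by have [+ _] := sS n; rewrite lt_min => /andP[_ /ltW].
  + exact: cvg_cst.
  + exact: cvg_harmonic.
- by case=> [|n]; [have [] := gP (0%N, 1)|have [] := sS n].
Qed.

(** * Lebesgue measure of the trace of a set on an interval *)

Section leb_theory.
Variable R : realType.
Implicit Types (S E : set R) (a b c x : R).

Lemma lebesgue_measurable_itv a b : lebesgue_measurable `[a, b]%classic.
Proof. by apply: sub_caratheodory; exact: measurable_itv. Qed.

Lemma leb_itv a b : a <= b -> leb `[a, b]%classic = b - a.
Proof.
move=> ab; rewrite /leb completed_lebesgue_measureE lebesgue_measure_itv/=.
rewrite lte_fin; case: ltP => //= ba.
by rewrite (@le_anti _ _ a b) ?subrr// ab.
Qed.

Lemma completed_lebesgue_measure_itv_fin S a b : lebesgue_measurable S ->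
  completed_lebesgue_measure (S `&` `[a, b]) \is a fin_num.
Proof.
move=> mS; rewrite ge0_fin_numE ?measure_ge0//.
apply: (@le_lt_trans _ _ (completed_lebesgue_measure `[a, b]%classic)).
  apply: le_outer_measure; exact: subIsetr.
rewrite completed_lebesgue_measureE lebesgue_measure_itv/=.
by case: ifP => _; rewrite -?EFinB ltry.
Qed.

Lemma leb_ge0 S : 0 <= leb S.
Proof. by apply: fine_ge0; exact: outer_measure_ge0. Qed.

Lemma leb_setCI S a b : lebesgue_measurable S -> a <= b ->
  leb (~` S `&` `[a, b]) = b - a - leb (S `&` `[a, b]).
Proof.
move=> mS ab; rewrite -(leb_itv ab) /leb.
have mI := lebesgue_measurable_itv a b.
rewrite (measureDI _ mI mS) setDE [in RHS]setIC (setIC _ S).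
rewrite fineD ?addrK//; apply: completed_lebesgue_measure_itv_fin => //.
exact: measurableC.
Qed.

Lemma leb_setI_le S a b : lebesgue_measurable S -> a <= b ->
  leb (S `&` `[a, b]) <= b - a.
Proof. by move=> mS ab; rewrite -subr_ge0 -leb_setCI// leb_ge0. Qed.

Lemma leb_setI_split S a b c : lebesgue_measurable S -> a <= b -> b <= c ->
  leb (S `&` `[a, c]) = leb (S `&` `[a, b]) + leb (S `&` `[b, c]).
Proof.
move=> mS ab bc; have mac := lebesgue_measurable_itv a c.
have mab := lebesgue_measurable_itv a b.
have mbc := lebesgue_measurable_itv b c.
rewrite /leb -fineD; [|exact: completed_lebesgue_measure_itv_fin..].
congr fine.
have mSac : lebesgue_measurable (S `&` `[a, c]) by exact: measurableI.
have mSbc : lebesgue_measurable (S `&` `[b, c]) by exact: measurableI.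
(* Removing [[a, b]] from [[a, c]] leaves []b, c]], which differs from [[b, c]] by the null set
   [[set b]]. *)
rewrite (measureDI _ mSac mab) addeC; congr (_ + _)%E.
  congr completed_lebesgue_measure; apply/seteqP; split=> x /=; rewrite !in_itv/=.
    by move=> [[]].
  by move=> [Sx /andP[ax xb]]; do 2?split => //; apply/andP; split; lra.
have mb : lebesgue_measurable [set b].
  by apply: sub_caratheodory; exact: measurable_set1.
rewrite (measureDI _ mSbc mb) [X in (_ + X)%E](_ : _ = 0%E) ?adde0.
  congr completed_lebesgue_measure; apply/seteqP; split=> x /=; rewrite !in_itv/=.
    move=> [[Sx /andP[ax xc]] /negP]; rewrite ax/= -ltNge => bx; split.
      by split => //; rewrite ltW.
    by apply/eqP; rewrite gt_eqF.
  move=> [[Sx /andP[bx xc]] /eqP xb]; split.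
    by split => //; rewrite xc (le_trans ab).
  by apply/negP; rewrite negb_and -!ltNge (lt_neqAle b) eq_sym xb bx orbT.
apply: measure_negligible; first exact: measurableI.
exists [set b]; split => //.
exact: (lebesgue_measure_set1 b).
Qed.

Lemma leb_primitive E : lebesgue_measurable E ->
  exists f : R -> R, forall a b, a <= b -> leb (E `&` `[a, b]) = f b - f a.
Proof.
move=> mE.
(* The measure is counted from the origin, with a negative sign to its left. *)
exists (fun x => if 0 <= x then leb (E `&` `[0, x]) else - leb (E `&` `[x, 0])).
move=> a b ab; case: ifPn => [b0|]; case: ifPn => [a0|].
- by rewrite (leb_setI_split mE a0 ab) addrAC subrr add0r.
- by rewrite -ltNge opprK => /ltW a0; rewrite (leb_setI_split mE a0 b0) addrC.
- by rewrite -ltNge => b0; lra.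
- rewrite -!ltNge opprK => /ltW a0 /ltW b0.
  by rewrite (leb_setI_split mE ab b0) addrC addrK.
Qed.

End leb_theory.

(** * Density conditions read off a primitive of the indicator *)

Section lip_primitive.
Variables (R : realType) (E : set R) (f : R -> R).
Hypothesis mE : lebesgue_measurable E.
Hypothesis fE : forall a b, a <= b -> leb (E `&` `[a, b]) = f b - f a.

Lemma primitive_homo : {homo f : x y / x <= y}.
Proof. by move=> a b ab; rewrite -subr_ge0 -fE// leb_ge0. Qed.
Let nf := primitive_homo.

Let lf a b : a <= b -> f b - f a <= b - a.
Proof. by move=> ab; rewrite -fE// leb_setI_le. Qed.

Lemma primitive_continuous : continuous f.
Proof.
move=> x; apply/cvgrPdist_lt => e e0; exists e => //= y.
apply: le_lt_trans.
have [xy|/ltW yx] := leP x y.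
  by rewrite distrC [leRHS]distrC !ger0_norm ?subr_ge0 ?lf// nf.
by rewrite !ger0_norm ?subr_ge0 ?lf// nf.
Qed.

Let q x r := Num.max (leb (E `&` `[x - r, x]) / r)
                     (leb (E `&` `[x, x + r]) / r).

Let oscqE x r : 0 < r -> q x r = oscq f x r.
Proof. by move=> r0; rewrite /q /oscq !fE//; lra. Qed.

Let oscq_le1 x r : 0 < r -> oscq f x r <= 1.
Proof.
move=> r0; rewrite ge_max !ler_pdivrMr// !mul1r.
by apply/andP; split; apply: (le_trans (lf _)); lra.
Qed.

(** The maximum of the one-sided densities never exceeds 1, so only the lower bound matters: it must
    approach 1 for all small radii. *)
Lemma lip_primitive_eq1 x :
  lip f x = 1%:E <-> strongly_one_sided_dense_at E x.
Proof.
split=> [fx r r0 _ rn|Ex].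
  have : (1%:E <= lip f x)%E by rewrite fx.
  move/(ge_lipP _ _ nf) => H.
  apply/cvgrPdist_lt => e e0; have [d d0 {}H] := H _ e0.
  move/cvgrPdist_lt: rn => /(_ d d0); apply: filterS => n.
  rewrite sub0r normrN gtr0_norm// => rd.
  rewrite -/(q x (r n)) oscqE// ger0_norm ?subr_ge0 ?oscq_le1//.
  by have := H (r n); rewrite r0 => /(_ rd); lra.
apply/eqP; rewrite eq_le; apply/andP; split.
  apply/(le_lipP _ _ nf) => e d e0 d0; exists (d / 2); first by apply/andP; split; lra.
  by rewrite (le_lt_trans (oscq_le1 _ _)) ?ltrDl//; lra.
(* If the bound fails, arbitrarily small radii have quotient at most [1 - e]; a monotone null
   sequence of them contradicts strong density. *)
apply/(ge_lipP _ _ nf) => e e0; apply: contrapT => /forall2NP H.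
have [|s [s0 sni scvg sP]] :=
    @small_positive_seq R (fun _ r => oscq f x r <= 1 - e).
  move=> _ d d0; have [//|/existsNP[r /not_implyP[rd /negP]]] := H d.
  by rewrite -leNgt => ?; exists r.
have := Ex s s0 sni scvg; move/cvgrPdist_lt => /(_ e e0)[N _ /(_ N (leqnn N))] /=.
by rewrite -/(q x (s N)) oscqE// => /ltr_normlW; have := sP N; lra.
Qed.

Let leb_center x r : 0 < r ->
  let I := `[x - r, x + r]%classic in
  leb (~` E `&` I) / leb I = 1 - (f (x + r) - f (x - r)) / (2 * r).
Proof.
move=> r0 I; have xr : x - r <= x + r by lra.
rewrite leb_setCI// leb_itv// fE//.
have -> : x + r - (x - r) = 2 * r by ring.
by field; rewrite gt_eqF.
Qed.

(** The density of [E] in the centered interval is the mean of the two one-sided quotients. Since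
    these are nonnegative, mean <= maximum <= 2 mean, and both become small along the same radii. *)
Lemma lip_primitive_eq0 x :
  lip f x = 0%:E <-> weakly_center_dense_at (~` E) x.
Proof.
have lebI r : 0 < r -> leb `[x - r, x + r]%classic = 2 * r.
  by move=> r0; rewrite leb_itv; [ring|lra].
split=> [fx|[r [r0 rI rE]]].
  have : (lip f x <= 0%:E)%E by rewrite fx.
  move=> /(le_lipP _ _ nf) H.
  have [|s [s0 _ scvg sP]] :=
      @small_positive_seq R (fun n r => oscq f x r < n.+1%:R^-1).
    move=> n d d0; have n0 : 0 < n.+1%:R^-1 :> R by rewrite invr_gt0.
    by have [r rd] := H _ _ n0 d0; rewrite add0r; exists r.
  exists s; split => //.
    under eq_fun do rewrite lebI//.
    by rewrite -(mulr0 2); apply: cvgM => //; exact: cvg_cst.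
  under eq_fun do rewrite leb_center//.
  suff cq : (f (x + s n) - f (x - s n)) / (2 * s n) @[n --> \oo] --> (0 : R).
    by have := cvgB (cvg_cst (1 : R)) cq; rewrite subr0; exact.
  apply: (@squeeze_cvgr _ _ _ _ (cst 0) (fun n => n.+1%:R^-1)).
  - apply: nearW => n; have := sP n; have sn := s0 n.
    rewrite gt_max !ltr_pdivrMr// ler_pdivrMr ?mulr_gt0// => /andP[h1 h2].
    have h0 : f (x - s n) <= f (x + s n) by apply: nf; lra.
    rewrite divr_ge0 ?mulr_ge0 ?(ltW sn) ?subr_ge0//= mulrCA.
    move: h1 h2; move: (n.+1%:R^-1 * s n) => c; lra.
  - exact: cvg_cst.
  - exact: cvg_harmonic.
apply/eqP; rewrite eq_le; apply/andP; split; last first.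
  apply/(ge_lipP _ _ nf) => e e0; exists 1 => // s /andP[s0 _].
  by have := oscq_ge0 x nf s0; lra.
apply/(le_lipP _ _ nf) => e d e0 d0.
(* Halving [e] pays for the factor 2 between the maximum and the mean. *)
have e20 : 0 < e / 2 by rewrite divr_gt0.
move/cvgrPdist_lt : rI => /(_ d d0) rI.
move/cvgrPdist_lt : rE => /(_ _ e20) rE.
have [n /= []] := filter_ex (filterI rI rE).
have rn := r0 n; rewrite leb_center// lebI// => rd.
rewrite opprB addrC subrK => re.
exists (r n).
  rewrite rn /=; move: rd; rewrite sub0r normrN gtr0_norm; lra.
have := ler_normlW (ltW re).
move: re => /ltr_normlW; rewrite ltr_pdivrMr ?mulr_gt0// add0r => re _.
have [] : f (x - r n) <= f x /\ f x <= f (x + r n) by split; apply: nf; lra.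
by move=> h1 h2; rewrite gt_max !ltr_pdivrMr//; apply/andP; split; lra.
Qed.

End lip_primitive.

(** * The equivalence for monotone functions *)

Theorem theorem3p4 (R : realType) (E : set R) :
  monotone_lip1 E <->
  strongly_one_sided_dense E /\ weakly_center_dense (~` E).
Proof.
split=> [[f [cf mf fE]]|[[mE dE] [mCE dCE]]].
  (* Replacing [f] by its opposite preserves [lip f] and reverses the monotonicity. *)
  wlog nf : f cf mf fE / {homo f : x y / x <= y}.
    move=> H; case: (mf) => [nf|nf]; first exact: (H f).
    have nNf : {homo (\- f) : x y / x <= y} by move=> x y xy /=; rewrite lerN2 nf.
    apply: (H (\- f)) => //.
    - by move=> x; apply: cvgN; exact: cf.
    - by left.
    - by move=> x; rewrite lip_oppr.
  have [mE EE] := lip_indic_leb cf nf fE.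
  split; split => //; [|exact: measurableC|] => x Ex.
  - by apply/(lip_primitive_eq1 mE EE); rewrite fE indicE mem_set.
  - by apply/(lip_primitive_eq0 mE EE); rewrite fE indicE memNset.
have [f EE] := leb_primitive mE.
exists f; split; first exact: (primitive_continuous mE EE).
  by left; exact: (primitive_homo EE).
(* The two values of the indicator correspond to the two density conditions, applied at points of
   [E] and of its complement. *)
move=> x; rewrite indicE; case: (boolP (x \in E)) => [/set_mem|/negP] xE /=.
  by apply/(lip_primitive_eq1 mE EE)/dE.
by apply/(lip_primitive_eq0 mE EE)/dCE => /mem_set.
Qed.
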